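(* Let $P_0$ be a convex $8$-gon in the plane with $4$-fold rotational symmetry, and let $\{P_j\}_{j\in\mathbb{Z}}$, $P_j=T_3^j(P_0)$, be its $(8,3)$-pentagram orbit. Then $P_0$ is regular if and only if $P_j$ is convex for all $j\in\mathbb{Z}$. More precisely: (1) $P_0$ has $8$-fold dihedral symmetry, with symmetry lines containing the vertices, if and only if $P_j$ is convex for all $j\ge 0$. (2) $P_0$ has $8$-fold dihedral symmetry, with symmetry lines bisecting the edges, if and only if $P_j$ is convex for all $j\le 0$.
   Context: The plane $\mathbb{R}^2$ is regarded as the standard affine patch of the real projective plane $\mathbb{RP}^2$ via $(x,y)\mapsto[x:y:1]$. An $8$-gon is a cyclically ordered sequence of vertices $v_i$, $i\in\mathbb{Z}/8$, in $\mathbb{RP}^2$. It is convex if, after applying a suitable projective transformation, its vertices, in the given cyclic order, are the consecutive vertices of a (strictly) convex $8$-gon in the standard affine patch. Given an $8$-gon $P$ with vertices $v_i$, the $8$-gon $T_3(P)$ is obtained by intersecting successive $3$-diagonals of $P$: its vertices are, in cyclic order, $w_i=\overline{v_iv_{i+3}}\cap\overline{v_{i+1}v_{i+4}}$, $i\in\mathbb{Z}/8$, where $\overline{ab}$ is the projective line through $a$ and $b$. (The precise labeling is immaterial here.) The map $T_3$ is generically defined and invertible; its inverse sends the $8$-gon with vertices $w_i$ to the $8$-gon with vertices $v_i=\ell_i\cap\ell_{i-3}$, where $\ell_i=\overline{w_{i-1}w_i}$. Both $T_3$ and $T_3^{-1}$ are defined on all convex $8$-gons, but their images need not be convex. The statement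 ''$P_j$ is convex for all $j\ge0$'' (resp. for all $j\le 0$, for all $j$) means that all the corresponding iterates $T_3^j(P_0)$ are defined and convex. An $8$-gon has $4$-fold rotational symmetry if there is a rotation of the plane by $90$ degrees about some center which preserves the polygon, shifting vertex labels by $2$ or by $-2$. It has $8$-fold dihedral symmetry if it is preserved by a dihedral group of Euclidean isometries of order $8$ ($4$ rotations and $4$ reflections). ''Symmetry lines containing the vertices'' means that the lines of the $4$ reflections pass through the vertices of the polygon; ''symmetry lines bisecting the edges'' means that these lines pass through the midpoints of the edges and bisect them. The regular (convex) $8$-gon has both kinds of symmetry. *)

(* Defs.v *)
From HB Require Import structures.
From mathcomp Require Import all_boot all_order all_algebra.
From mathcomp Require Import reals trigo.

Set Implicit Arguments.
Unset Strict Implicit.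
Unset Printing Implicit Defensive.

Import Order.TTheory GRing.Theory Num.Theory.

Local Open Scope ring_scope.

(** * The real projective plane

    Points and lines of RP^2 are the 1- and 2-dimensional subspaces of R^3, so
    the line through two distinct points is their sum and the common point of
    two distinct lines is their intersection. *)

Section Projective.
Variable R : realType.

Definition plane : Type := (R * R)%type.

Definition projective : Type := {vspace 'rV[R]_3}.

(* [x : y : 1] *)
Definition affine_pt (a : plane) : projective :=
  <[ \row_(j < 3) [:: a.1; a.2; 1]`_j ]>%VS.

Definition plane_octagon : Type := 'Z_8 -> plane.

(* All the octagons considered below have 1-dimensional entries: affine_pt is
   1-dimensional, and T3 and T3inv return intersections of distinct lines. *)
Definition octagon : Type := 'Z_8 -> projective.

Definition affine_octagon (p : plane_octagon) : octagon :=
  fun i => affine_pt (p i).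

(** * Convexity *)

(* Twice the signed area of the triangle a b c. *)
Definition orient (a b c : plane) : R :=
  (b.1 - a.1) * (c.2 - a.2) - (b.2 - a.2) * (c.1 - a.1).

(* The two cases are the counterclockwise and the clockwise labelings. *)
Definition strictly_convex (q : plane_octagon) : Prop :=
  (forall i j : 'Z_8, j != i -> j != i + 1 ->
     0 < orient (q i) (q (i + 1)) (q j)) \/
  (forall i j : 'Z_8, j != i -> j != i + 1 ->
     orient (q i) (q (i + 1)) (q j) < 0).

(* A projective transformation is induced by an invertible endomorphism g. *)
Definition convex (P : octagon) : Prop :=
  exists (g : 'End('rV[R]_3)) (q : plane_octagon),
    [/\ lker g == 0%VS,
        strictly_convex q
      & forall i, (g @: P i)%VS = affine_pt (q i)].

(** * The map T_3 and its inverse, as partial maps *)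

Definition diagonal (P : octagon) (i : 'Z_8) : projective :=
  (P i + P (i + 3%:R)%R)%VS.

Definition T3 (P : octagon) : option octagon :=
  if [forall i : 'Z_8, (P i != P (i + 3%:R)) &&
                       (diagonal P i != diagonal P (i + 1))]
  then Some (fun i => (diagonal P i :&: diagonal P (i + 1)%R)%VS)
  else None.

Definition edge (P : octagon) (i : 'Z_8) : projective :=
  (P (i - 1)%R + P i)%VS.

Definition T3inv (P : octagon) : option octagon :=
  if [forall i : 'Z_8, (P (i - 1) != P i) &&
                       (edge P i != edge P (i - 3%:R))]
  then Some (fun i => (edge P i :&: edge P (i - 3%:R)%R)%VS)
  else None.

Definition T3orbit (P : octagon) (j : int) : option octagon :=
  match j with
  | Posz n => iter n (obind T3) (Some P)
  | Negz n => iter n.+1 (obind T3inv) (Some P)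
  end.

Definition orbit_convex_at (P : octagon) (j : int) : Prop :=
  exists2 Q : octagon, T3orbit P j = Some Q & convex Q.

(** * Euclidean symmetries *)

Definition rotation (c : plane) (t : R) (x : plane) : plane :=
  (c.1 + (cos t * (x.1 - c.1) - sin t * (x.2 - c.2)),
   c.2 + (sin t * (x.1 - c.1) + cos t * (x.2 - c.2))).

(* The line through c with direction (cos t, sin t). *)
Definition on_line (c : plane) (t : R) (x : plane) : Prop :=
  (x.1 - c.1) * sin t = (x.2 - c.2) * cos t.

(* The reflection in that line. *)
Definition reflection (c : plane) (t : R) (x : plane) : plane :=
  (c.1 + (cos (2 * t) * (x.1 - c.1) + sin (2 * t) * (x.2 - c.2)),
   c.2 + (sin (2 * t) * (x.1 - c.1) - cos (2 * t) * (x.2 - c.2))).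

Definition midpoint (a b : plane) : plane :=
  ((a.1 + b.1) / 2, (a.2 + b.2) / 2).

Definition rotation_symmetric4 (p : plane_octagon) : Prop :=
  exists c : plane,
    (forall i, rotation c (pi / 2) (p i) = p (i + 2%:R)) \/
    (forall i, rotation c (pi / 2) (p i) = p (i - 2%:R)).

(* f maps vertices to vertices and edges to edges. *)
Definition preserves (f : plane -> plane) (p : plane_octagon) : Prop :=
  (exists k : 'Z_8, forall i, f (p i) = p (i + k)) \/
  (exists k : 'Z_8, forall i, f (p i) = p (k - i)).

(* Every dihedral group of order 8 of Euclidean isometries consists of the
   rotations by multiples of pi/2 about a center c and of the reflections in
   four lines through c, consecutive ones at angle pi/4. *)
Definition mirror_angle (t : R) (k : 'I_4) : R := t + k%:R * (pi / 4%:R).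

Definition dihedral8_preserves (c : plane) (t : R) (p : plane_octagon) : Prop :=
  forall k : 'I_4,
    preserves (rotation c (k%:R * (pi / 2))) p /\
    preserves (reflection c (mirror_angle t k)) p.

Definition dihedral8_through_vertices (p : plane_octagon) : Prop :=
  exists (c : plane) (t : R),
    [/\ dihedral8_preserves c t p,
        forall k : 'I_4, exists i, on_line c (mirror_angle t k) (p i)
      & forall i, exists k : 'I_4, on_line c (mirror_angle t k) (p i)].

Definition bisects (c : plane) (t : R) (a b : plane) : Prop :=
  on_line c t (midpoint a b) /\ reflection c t a = b.

Definition dihedral8_bisecting_edges (p : plane_octagon) : Prop :=
  exists (c : plane) (t : R),
    [/\ dihedral8_preserves c t p,
        forall k : 'I_4, exists i, bisects c (mirror_angle t k) (p i) (p (i + 1))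
      & forall i, exists k : 'I_4,
          bisects c (mirror_angle t k) (p i) (p (i + 1))].

(* Eight equally spaced points on a circle, in counterclockwise (s = false) or
   clockwise (s = true) order. *)
Definition regular (p : plane_octagon) : Prop :=
  exists (c : plane) (r t : R) (s : bool),
    0 < r /\
    forall i : 'Z_8,
      let a := t + (-1) ^+ s * (i%:R * (pi / 4%:R)) in
      p i = (c.1 + r * cos a, c.2 + r * sin a).

End Projective.

(* Main.v *)
Require Import Defs.
From mathcomp Require Import all_boot all_order all_algebra.
From mathcomp Require Import ring lra.
From mathcomp Require Import boolp reals trigo.

Set Implicit Arguments.
Unset Strict Implicit.
Unset Printing Implicit Defensive.

Import Order.TTheory GRing.Theory Num.Theory.

Local Open Scope ring_scope.

(** Put the center of rotation at 0 and identify the plane with the complex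
    numbers. Up to a similarity, possibly reversing the orientation, a symmetric
    octagon has the vertices 1, z, i, iz, -1, -z, -i, -iz, so that it is
    determined by its shape z = x + iy. Projective convexity of the octagon is
    equivalent to x + y > 1 and |z|^2 < x + y ([convex_half_disc],
    [oct_convex]): convex shapes form an open half disc with corners 1 and i.
    The dihedral octagons with mirrors through the vertices are those on its
    axis x = y, the ones with mirrors bisecting the edges those on the arc
    |z| = 1, and the regular ones are the common point of the two.

    The map and its inverse commute with similarities, hence act on shapes, by
    the rational maps [T3_shape] and [T3inv_shape] of the half disc to the plane.
    The regular shape is a fixed point of saddle type; the axis x = y is its
    stable curve and the arc |z| = 1 its unstable curve. Global expansion away
    from these curves is visible in exact formulas:

    - for the map, the defect s = x - y is multiplied by - (d / n)^2 where
      d = x + y + |z|^2 and n = |z^2 + s| ([T3_diag_defect]), and this factor is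
      at least 36/25 in absolute value if the image is still in the half disc
      ([T3_expands]);
    - for the inverse map, the defect 1 - |z|^2 is multiplied by a negative
      number, of absolute value at least 4/3 if the image is still in the half
      disc ([T3inv_expands]).

    Both defects are bounded on the half disc, so the shape can stay there
    forever only if the defect vanishes ([expanding_never_leaves]). Conversely,
    the axis and the arc are mapped to themselves inside the half disc
    ([T3_diagonal], [T3inv_circle]). The three equivalences are then
    comparisons of symmetry conditions with the equations x = y and |z| = 1. *)

(** * Points and lines of the affine patch *)

Section Projective.
Variable R : realType.
Implicit Types (a b c w : plane R) (p : plane_octagon R).

Definition homog a : 'rV[R]_3 := \row_(j < 3) [:: a.1; a.2; 1]`_j.

Lemma homog_neq0 a : homog a != 0.
Proof.
apply/eqP => /rowP /(_ ord_max); rewrite !mxE /= => /eqP.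
by rewrite oner_eq0.
Qed.

Definition rows3 (u v w : 'rV[R]_3) : 'M[R]_3 :=
  \matrix_(i < 3) [:: u; v; w]`_i.

Lemma det_rows3_homog a b c :
  \det (rows3 (homog a) (homog b) (homog c)) = orient a b c.
Proof.
rewrite (expand_det_row _ ord0) !big_ord_recl big_ord0 /cofactor.
rewrite !(expand_det_row _ ord0) !big_ord_recl !big_ord0 /cofactor.
rewrite !det_mx11 !mxE /= /orient.
by ring.
Qed.

Lemma rows3_mulmx (u v w : 'rV[R]_3) (M : 'M[R]_3) :
  rows3 u v w *m M = rows3 (u *m M) (v *m M) (w *m M).
Proof.
apply/row_matrixP => i; rewrite row_mul !rowK.
by case: i => [[|[|[|]]]].
Qed.

Lemma det_rows3_scale (k l m : R) (u v w : 'rV[R]_3) :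
  \det (rows3 (k *: u) (l *: v) (m *: w)) = k * l * m * \det (rows3 u v w).
Proof.
rewrite !(expand_det_row _ ord0) !big_ord_recl !big_ord0 /cofactor.
rewrite !(expand_det_row _ ord0) !big_ord_recl !big_ord0 /cofactor.
rewrite !det_mx11 !mxE /=.
by ring.
Qed.

Lemma affine_pt_inj : injective (@affine_pt R).
Proof.
move=> a b /= eq_ab.
have /vlineP[k ek] : homog a \in affine_pt b by rewrite -eq_ab memv_line.
have e j := congr1 (fun v : 'rV[R]_3 => v 0 j) ek.
have := e 0; have := e 1; have := e ord_max; rewrite !mxE /= mulr1 => <-.
by rewrite !mul1r; case: (a) (b) => ? ? [? ?] /= -> ->.
Qed.

(** Cramer's rule: in the basis formed by the lifts of [a], [b] and [c], the
    coordinate of the lift of [w] on that of [c] is proportional to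
    [orient a b w]. *)
Lemma collinear_in_line a b c w :
  orient a b c != 0 -> orient a b w = 0 ->
  homog w \in (affine_pt a + affine_pt b)%VS.
Proof.
move=> abc abw.
have cramer : orient a b c *: homog w =
    orient w b c *: homog a + orient a w c *: homog b + orient a b w *: homog c.
  by apply/rowP; case=> [[|[|[|]]]] // ?; rewrite !mxE /= /orient; ring.
have -> : homog w = (orient a b c)^-1 *: (orient a b c *: homog w).
  by rewrite scalerA mulVf // scale1r.
rewrite cramer abw scale0r addr0 memvZ // memv_add //; apply: memvZ;
  exact: memv_line.
Qed.

Lemma notin_line a b c :
  orient a b c != 0 -> homog c \notin (affine_pt a + affine_pt b)%VS.
Proof.
apply: contraNN => /memv_addP[_ /vlineP[k ->] [_ /vlineP[l ->]]] e.
have e' j := congr1 (fun v : 'rV[R]_3 => v 0 j) e.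
have := e' 0; have := e' 1; have := e' ord_max; rewrite !mxE /= !mulr1.
rewrite /orient => kl -> ->; have -> : k = 1 - l by rewrite kl addrK.
by apply/eqP; ring.
Qed.

(** The dimension of the intersection is squeezed: it contains the line [w] of
    R^3 over [w] and is a proper subspace of the plane over the line [c d], as
    [c] is not on the line [a b]. *)
Lemma lines_meet a b c d e w :
  orient a b c != 0 -> orient c d e != 0 ->
  orient a b w = 0 -> orient c d w = 0 ->
  ((affine_pt a + affine_pt b) :&: (affine_pt c + affine_pt d))%VS =
    affine_pt w.
Proof.
move=> abc cde abw cdw; apply/esym/eqP; rewrite eqEdim; apply/andP; split.
  rewrite subv_cap -!memvE.
  by rewrite (collinear_in_line abc abw) (collinear_in_line cde cdw).
rewrite dim_vline homog_neq0 -ltnS.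
set L := (affine_pt c + affine_pt d)%VS.
have dimL : (\dim L <= 2)%N.
  apply: leq_trans (dimv_add_leqif _ _) _.
  by rewrite !dim_vline !homog_neq0.
apply: leq_trans dimL; rewrite (ltn_leqif (dimv_leqif_eq (capvSr _ _))).
apply: contra (notin_line abc) => /eqP capL.
have : homog c \in L by rewrite memvE addvSl.
by rewrite -capL memv_cap => /andP[].
Qed.

Lemma lines_neq a b c d :
  orient a b c != 0 ->
  (affine_pt a + affine_pt b)%VS != (affine_pt c + affine_pt d)%VS.
Proof.
move=> abc; apply: contra (notin_line abc) => /eqP ->.
by rewrite memvE addvSl.
Qed.

Lemma orient_neq a b c : orient a b c != 0 -> affine_pt a != affine_pt b.
Proof.
by apply: contra => /eqP/affine_pt_inj ->; apply/eqP; rewrite /orient; ring.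
Qed.

(** * Convexity by signs of determinants *)

Lemma strictly_convex_convex p :
  strictly_convex p -> convex (affine_octagon p).
Proof.
move=> cvx; exists \1%VF, p; split=> // [|i]; last by rewrite lim1g.
by apply/lker0P => u v; rewrite !id_lfunE.
Qed.

(** A linear map of R^3 multiplies all determinants by one constant; the
    scalars [l] absorb both this constant and the choice of lifts of the points
    to R^3. *)
Lemma convex_signs p : convex (affine_octagon p) ->
  exists l : 'Z_8 -> R, forall i j : 'Z_8, j != i -> j != i + 1 ->
    0 < l i * l (i + 1) * l j * orient (p i) (p (i + 1)) (p j).
Proof.
move=> [g [q [_ cvx gpq]]].
have /choice[m mE] i : exists k, homog (q i) = k *: g (homog (p i)).
  by apply/vlineP; rewrite -limg_line gpq memv_line.
pose k := \det (lin1_mx g).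
have qE i j h :
    orient (q i) (q j) (q h) = m i * m j * m h * (k * orient (p i) (p j) (p h)).
  rewrite -!det_rows3_homog !mE det_rows3_scale; congr (_ * _).
  by rewrite -!(mul_rV_lin1 g) -rows3_mulmx det_mulmx mulrC.
(* Scaling [l] by u scales the products below by u^3, which has the sign of u:
   this is how the sign of [k] is absorbed. *)
have cubic i j h u : (u * m i) * (u * m j) * (u * m h) * orient (p i) (p j) (p h)
    = u ^+ 3 * (m i * m j * m h * orient (p i) (p j) (p h)) by ring.
have k_neq0 : k != 0.
  have : orient (q 0) (q (0 + 1)) (q 2) != 0.
    by case: cvx => /(_ 0 2 isT isT); rewrite lt_def => /andP[] // ; rewrite eq_sym.
  by rewrite qE; apply: contraNneq => ->; rewrite mul0r mulr0.
have k2_gt0 : 0 < k ^+ 2 by rewrite exprn_even_gt0 //= k_neq0.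
case: cvx => cvx; [exists (fun i => k * m i) | exists (fun i => - k * m i)];
  move=> i j ji ji1; have := cvx i j ji ji1; rewrite cubic qE.
- have -> : k ^+ 3 * (m i * m (i + 1) * m j * orient (p i) (p (i + 1)) (p j)) =
    k ^+ 2 * (m i * m (i + 1) * m j * (k * orient (p i) (p (i + 1)) (p j)))
    by ring.
  exact: mulr_gt0.
- have -> : (- k) ^+ 3 * (m i * m (i + 1) * m j * orient (p i) (p (i + 1)) (p j))
    = - (k ^+ 2 * (m i * m (i + 1) * m j * (k * orient (p i) (p (i + 1)) (p j))))
    by ring.
  by move=> neg; rewrite oppr_gt0 pmulr_rlt0.
Qed.

End Projective.

(** * Octagons with a quarter-turn symmetry *)

(** A quarter turn shifts the labels by 2, so that a property which it
    preserves need only be checked for two labels. *)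
Lemma Z8_ind2 (Q : 'Z_8 -> Prop) :
  Q 0 -> Q 1 -> (forall i, Q i -> Q (i + 2%:R)) -> forall i, Q i.
Proof.
move=> Q0 Q1 Q2 i; rewrite -(natr_Zp i); move: (nat_of_ord i) => n {i}.
suff [] : Q n%:R /\ Q n.+1%:R by [].
elim: n => [|n [Qn Qn1]]; first by [].
split=> //; have -> : n.+2%:R = n%:R + 2%:R :> 'Z_8 by rewrite -natrD addn2.
exact: Q2.
Qed.

Lemma Z8_addI (i m n : 'Z_8) : (i + m == i + n) = (m == n).
Proof. exact: (inj_eq (addrI i)). Qed.

Lemma Z8_addI0 (i m : 'Z_8) : (i + m == i) = (m == 0).
Proof. by rewrite -{2}[i]addr0 Z8_addI. Qed.

Section Octagons.
Variable R : realType.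
Implicit Types (a b c u v w z : plane R) (s : bool).

Lemma sqr_factor_gt0 (q m : R) : 0 < m * q ^+ 2 -> 0 < m.
Proof.
move=> mq; rewrite -(pmulr_lgt0 _ (_ : 0 < q ^+ 2)) //.
by rewrite lt_def sqr_ge0 andbT; apply: contraTneq mq => ->; rewrite mulr0 ltxx.
Qed.

Definition quarter u : plane R := (- u.2, u.1).

Definition turns u v (i : 'Z_8) : plane R :=
  iter i./2 quarter (if odd i then v else u).

Lemma quarter4 u : quarter (quarter (quarter (quarter u))) = u.
Proof. by case: u => x y; rewrite /quarter /= !opprK. Qed.

Lemma turns_add2 u v i : turns u v (i + 2%:R) = quarter (turns u v i).
Proof.
by case: i => [[|[|[|[|[|[|[|[|]]]]]]]]] // ?; rewrite /turns /= ?quarter4.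
Qed.

Lemma turns0 u v : turns u v 0 = u.
Proof. by []. Qed.

Lemma turns1 u v : turns u v 1 = v.
Proof. by []. Qed.

Definition cmul u v : plane R := (u.1 * v.1 - u.2 * v.2, u.1 * v.2 + u.2 * v.1).
Definition conj_if s u : plane R := (u.1, (-1) ^+ s * u.2).
Definition sqnorm u : R := u.1 ^+ 2 + u.2 ^+ 2.
Definition cdiv u v : plane R :=
  ((u.1 * v.1 + u.2 * v.2) / sqnorm v, (u.2 * v.1 - u.1 * v.2) / sqnorm v).

Lemma sqnorm_eq0 u : (sqnorm u == 0) = (u == 0).
Proof.
case: u => x y; rewrite /sqnorm /= paddr_eq0 ?sqr_ge0 // !sqrf_eq0.
by rewrite -[RHS]/((x == 0) && (y == 0)).
Qed.

Lemma cmulK u v : v != 0 -> cmul v (cdiv u v) = u.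
Proof.
rewrite -sqnorm_eq0 /sqnorm /cmul /cdiv /sqnorm => v0.
by case: u v v0 => [x y] [x' y'] /= v0; congr (_, _); field.
Qed.

Lemma turns_cmul w u v i : turns (cmul w u) (cmul w v) i = cmul w (turns u v i).
Proof.
elim/Z8_ind2: i => // i IH; rewrite !turns_add2 IH.
by rewrite /quarter /cmul /=; congr (_, _); ring.
Qed.

(** The vertices 1, z, i, iz, -1, -z, -i, -iz of the complex plane. *)
Definition model z : plane_octagon R := turns (1, 0) z.

Lemma turns_model u v i : u != 0 -> turns u v i = cmul u (model (cdiv v u) i).
Proof.
move=> u0; rewrite -turns_cmul cmulK //; congr (turns _ _ _).
by case: u {u0} => x y; rewrite /cmul /=; congr (_, _); ring.
Qed.

(** A similarity, which reverses the orientation when [s] is true. *)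
Definition simil c a s u : plane R := c + cmul a (conj_if s u).

Lemma similE c a s u : simil c a s u =
  (c.1 + (a.1 * u.1 - a.2 * ((-1) ^+ s * u.2)),
   c.2 + (a.1 * ((-1) ^+ s * u.2) + a.2 * u.1)).
Proof. by []. Qed.

Definition oct c a s z : plane_octagon R := fun i => simil c a s (model z i).

Lemma orient_simil c a s u v w :
  orient (simil c a s u) (simil c a s v) (simil c a s w) =
  (-1) ^+ s * sqnorm a * orient u v w.
Proof. by rewrite !similE /orient /sqnorm /=; ring. Qed.

Lemma orient_quarter u v w :
  orient (quarter u) (quarter v) (quarter w) = orient u v w.
Proof. by rewrite /orient /quarter /=; ring. Qed.

Lemma simil_simil c a s u v :
  simil c a s (cmul u v) = simil c (cmul a (conj_if s u)) s v.
Proof.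
rewrite !similE /cmul /=; congr (_, _); case: s; rewrite ?expr0 ?expr1; ring.
Qed.

(** * The half disc of convex shapes *)

(** The part of the disc with diameter from 1 to i on the side of this diameter
    away from 0: the two conditions say that the model octagon turns left at z
    and at i. *)
Definition half_disc z : bool :=
  (1 < z.1 + z.2) && (sqnorm z < z.1 + z.2).

Lemma half_disc_pos z : half_disc z -> 0 < z.1 /\ 0 < z.2.
Proof.
by case: z => x y; rewrite /half_disc /sqnorm /= => /andP[h1 h2]; split; nra.
Qed.

Lemma half_disc_diff z : half_disc z -> -1 < z.1 - z.2 < 1.
Proof.
case: z => x y hz; have [] := half_disc_pos hz; move: hz.
rewrite /half_disc /sqnorm /= => /andP[h1 h2] x0 y0.
by apply/andP; split; nra.
Qed.

Lemma model_convex z : half_disc z -> forall i j : 'Z_8, j != i -> j != i + 1 ->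
  0 < orient (model z i) (model z (i + 1)) (model z j).
Proof.
move=> hz i; have [x0 y0] := half_disc_pos hz.
have /andP[d1 d2] := half_disc_diff hz.
elim/Z8_ind2: i => [||i IH] j.
- case: j => [[|[|[|[|[|[|[|[|]]]]]]]]] // ? _ _; move: hz x0 y0 d1 d2;
  case: z => x y; rewrite /half_disc /sqnorm /orient /model /turns /quarter /=;
  move=> /andP[h1 h2] *; nra.
- case: j => [[|[|[|[|[|[|[|[|]]]]]]]]] // ? _ _; move: hz x0 y0 d1 d2;
  case: z => x y; rewrite /half_disc /sqnorm /orient /model /turns /quarter /=;
  move=> /andP[h1 h2] *; nra.
- move=> ji ji1; have jE : j = (j - 2%:R) + 2%:R by rewrite subrK.
  rewrite jE (addrAC i) /model !turns_add2 orient_quarter; apply: IH.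
    by rewrite subr_eq.
  by rewrite subr_eq addrAC.
Qed.

Lemma oct_convex c a s z : a != 0 -> half_disc z -> strictly_convex (oct c a s z).
Proof.
move=> a0 hz; have n0 : 0 < sqnorm a.
  by rewrite lt_def sqnorm_eq0 a0 addr_ge0 ?sqr_ge0.
case: s; [right | left] => i j ji ji1; rewrite /oct orient_simil ?expr0 ?expr1.
  by rewrite mulN1r mulNr oppr_lt0 mulr_gt0 // model_convex.
by rewrite mul1r mulr_gt0 // model_convex.
Qed.

(** The triangles p_i p_(i+1) p_(i+4) and p_i p_(i+1) p_(i+5) have the same
    signed area because p_(i+4) and p_(i+5) are opposite to p_i and p_(i+1).
    Hence two consecutive scalars of [convex_signs] have the same sign, all
    scalars do, and the affine triangles themselves have a common sign. Four of
    these triangles give the claim: the areas of 1, z, -i and of z, i, -1 add up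
    to a positive number, so the common sign is positive, and then 1, z, i and
    1, z, -iz give the two inequalities. *)
Lemma convex_half_disc c a s z :
  convex (affine_octagon (oct c a s z)) -> half_disc z.
Proof.
move=> /convex_signs[l lP].
pose k := (-1) ^+ s * sqnorm a.
have {}lP i j : j != i -> j != i + 1 ->
    0 < l i * l (i + 1) * l j * k * orient (model z i) (model z (i + 1)) (model z j).
  by move=> ji ji1; rewrite -mulrA -(orient_simil c); apply: lP.
have step i : 0 < l i * l (i + 1).
  have {i} [i ->] : exists j, i = j + 4%:R by exists (i - 4%:R); rewrite subrK.
  set d := orient (model z i) (model z (i + 1)) (model z (i + 4%:R)).
  have d5 : orient (model z i) (model z (i + 1)) (model z (i + 4%:R + 1)) = d.
    have opp j : model z (j + 4%:R) = quarter (quarter (model z j)).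
      by rewrite -!turns_add2 -addrA.
    by rewrite /d addrAC !opp /orient /quarter /=; ring.
  have := lP i (i + 4%:R); rewrite Z8_addI0 Z8_addI => /(_ isT isT) T4.
  have := lP i (i + 5%:R); rewrite Z8_addI0 Z8_addI => /(_ isT isT).
  have -> : i + 5%:R = i + 4%:R + 1 by rewrite -addrA; congr (_ + _); apply: val_inj.
  rewrite d5 => /(mulr_gt0 T4); rewrite -/d.
  set m := l (i + 4%:R); set n := l (i + 4%:R + 1).
  by move=> T45; apply: (@sqr_factor_gt0 (l i * l (i + 1) * k * d)); lra.
have same i : 0 < l 0 * l i.
  rewrite -(natr_Zp i); elim: (nat_of_ord i) => [|n IH] {i}.
    by rewrite -expr2 exprn_even_gt0 //=;
      apply: contraTneq (step 0) => ->; rewrite mul0r ltxx.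
  have := mulr_gt0 IH (step n%:R); rewrite [n.+1%:R]mulrSr.
  by move=> ?; apply: (@sqr_factor_gt0 (l n%:R)); lra.
have {}lP i j : j != i -> j != i + 1 ->
    0 < l 0 * k * orient (model z i) (model z (i + 1)) (model z j).
  move=> ji ji1; have := lP i j ji ji1.
  rewrite -!mulrA (mulrA (l i)) (pmulr_rgt0 _ (step i)) => /(mulr_gt0 (same j)).
  by move=> ?; apply: (@sqr_factor_gt0 (l j)); lra.
have := lP 0 2%:R isT isT; have := lP 0 7%:R isT isT.
have := lP 0 6%:R isT isT; have := lP 1 4%:R isT isT.
rewrite /half_disc /sqnorm /orient /model /turns /quarter /=.
case: z {lP} => x y /=; move: (l 0 * k) => K t1 t2.
have K0 : 0 < K by nra.
by rewrite !(pmulr_rgt0 _ K0) => t3 t4; apply/andP; split; nra.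
Qed.

End Octagons.

(** * The action of the map and of its inverse on shapes *)

Section Shapes.
Variable R : realType.
Implicit Types (a b c u v w z : plane R) (s : bool).

(** The vertices with labels 0 and 1 of the image of the model octagon: the
    intersections of the lines through 1 and iz and through z and -1, and of the
    latter with the line through i and -z. *)
Definition T3_vertex0 z : plane R :=
  let: (x, y) := z in
  ((x - y) * (1 + x + y) / (x + y + sqnorm z), 2 * x * y / (x + y + sqnorm z)).

Definition T3_vertex1 z : plane R :=
  let: (x, y) := z in
  (x * (y - 1 - x) / (1 + x + y), y * (y + 1 - x) / (1 + x + y)).

(** The image of the model is again symmetric about 0, so that it is determined
    up to a similarity by the ratio of two consecutive vertices. *)
Definition T3_shape z : plane R := cdiv (T3_vertex1 z) (T3_vertex0 z).

(** For the inverse map, the vertex with label 0 is the intersection of the lines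
    through -iz and 1 and through -1 and -z, the one with label 1 that of the
    lines through 1 and z and through -z and -i. *)
Definition T3inv_vertex0 z : plane R :=
  let: (x, y) := z in
  (- ((x - y) * (x + y - 1)) / (x + y - sqnorm z),
   - (2 * x * y) / (x + y - sqnorm z)).

Definition T3inv_vertex1 z : plane R :=
  let: (x, y) := z in
  (x * (1 - (x - y)) / (x + y - 1), - (y * (1 + (x - y))) / (x + y - 1)).

Definition T3inv_shape z : plane R := cdiv (T3inv_vertex1 z) (T3inv_vertex0 z).

Lemma simil_turns c a s u v i : u != 0 ->
  simil c a s (turns u v i) = oct c (cmul a (conj_if s u)) s (cdiv v u) i.
Proof. by move=> u0; rewrite turns_model // simil_simil. Qed.

Lemma cmul_neq0 u v : u != 0 -> v != 0 -> cmul u v != 0.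
Proof.
rewrite -!sqnorm_eq0 => u0 v0.
have -> : sqnorm (cmul u v) = sqnorm u * sqnorm v.
  by rewrite /sqnorm /cmul /=; ring.
exact: mulf_neq0.
Qed.

Lemma conj_if_neq0 s u : u != 0 -> conj_if s u != 0.
Proof.
by rewrite -!sqnorm_eq0 /sqnorm /conj_if /= exprMn sqrr_sign mul1r.
Qed.

Lemma oct_orient_neq0 c a s z : a != 0 -> half_disc z ->
  forall i j : 'Z_8, j != i -> j != i + 1 ->
  orient (oct c a s z i) (oct c a s z (i + 1)) (oct c a s z j) != 0.
Proof.
move=> a0 hz i j ji ji1.
by case: (oct_convex c s a0 hz) => /(_ i j ji ji1);
  rewrite lt_def => /andP[] //; rewrite eq_sym.
Qed.

Lemma orient_perm a b c : orient a c b = - orient a b c.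
Proof. by rewrite /orient; ring. Qed.

(** Everything reduces to four collinearities for the model, since [orient] is
    multiplied by a constant under a similarity. The diagonals are distinct lines
    because p_i, p_(i+1) and p_(i+3) are not collinear. *)
Lemma T3_oct c a s z : a != 0 -> half_disc z ->
  exists2 a', a' != 0 &
    T3 (affine_octagon (oct c a s z)) =
      Some (affine_octagon (oct c a' s (T3_shape z))).
Proof.
move=> a0 hz; have [x0 y0] := half_disc_pos hz.
have w0 : T3_vertex0 z != 0.
  case: z {hz} x0 y0 => x y /= x0 y0; apply/eqP => -[_ /eqP].
  rewrite mulf_eq0 invr_eq0 /sqnorm /= => /orP[] /eqP; nra.
exists (cmul a (conj_if s (T3_vertex0 z))).
  by rewrite cmul_neq0 // conj_if_neq0.
pose p := oct c a s z.
have p013 i : orient (p i) (p (i + 3%:R)) (p (i + 1)) != 0.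
  by rewrite orient_perm oppr_eq0; apply: oct_orient_neq0;
     rewrite // ?Z8_addI0 ?Z8_addI.
rewrite /T3 ifT; last first.
  apply/forallP => i; apply/andP; split; first exact: orient_neq (p013 i).
  exact: lines_neq (p013 i).
congr Some; apply/funext => i; rewrite /affine_octagon /T3_shape.
rewrite -simil_turns //; apply: lines_meet (p013 i) (p013 (i + 1)) _ _.
all: rewrite /p /oct orient_simil; apply/eqP; rewrite mulf_eq0;
  apply/orP; right; apply/eqP.
all: elim/Z8_ind2: i; last by
  move=> i IH; rewrite ?(addrAC _ 2%:R) /model !turns_add2 orient_quarter.
all: rewrite /model /turns /orient /quarter /=;
  case: z {hz w0 p p013} x0 y0 => x y /= x0 y0;
  rewrite /sqnorm /=; field; rewrite ?andbT; try (apply/andP; split); apply/eqP; nra.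
Qed.

Lemma T3inv_oct c a s z : a != 0 -> half_disc z ->
  exists2 a', a' != 0 &
    T3inv (affine_octagon (oct c a s z)) =
      Some (affine_octagon (oct c a' s (T3inv_shape z))).
Proof.
move=> a0 hz; have [x0 y0] := half_disc_pos hz.
have w0 : T3inv_vertex0 z != 0.
  case: z hz x0 y0 => x y /andP[/= h1 h2] x0 y0; apply/eqP => -[_ /eqP].
  rewrite mulf_eq0 invr_eq0 => /orP[] /eqP; nra.
exists (cmul a (conj_if s (T3inv_vertex0 z))).
  by rewrite cmul_neq0 // conj_if_neq0.
pose p := oct c a s z.
have edges i : orient (p (i - 1)) (p i) (p (i - 3%:R - 1)) != 0.
  have := @oct_orient_neq0 c a s z a0 hz (i - 1) (i - 3%:R - 1).
  rewrite subrK addrAC Z8_addI0; apply => //.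
  by rewrite addrAC -addrA -[X in _ != X]addr0 Z8_addI.
have edges' i : orient (p (i - 3%:R - 1)) (p (i - 3%:R)) (p i) != 0.
  have := @oct_orient_neq0 c a s z a0 hz (i - 3%:R - 1) i.
  by rewrite subrK -addrA !(eq_sym i) !Z8_addI0; apply.
rewrite /T3inv ifT; last first.
  apply/forallP => i; apply/andP; split; first exact: orient_neq (edges i).
  exact: lines_neq (edges i).
congr Some; apply/funext => i; rewrite /affine_octagon /T3inv_shape.
rewrite -simil_turns //; apply: lines_meet (edges i) (edges' i) _ _.
all: rewrite /p /oct orient_simil; apply/eqP; rewrite mulf_eq0;
  apply/orP; right; apply/eqP.
all: elim/Z8_ind2: i; last by
  move=> i IH; rewrite ?(addrAC _ 2%:R) /model !turns_add2 orient_quarter.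
all: rewrite /model /turns /orient /quarter /=;
  case: z hz {w0 p edges edges'} x0 y0 => x y /= /andP[/= h1 h2] x0 y0;
  rewrite /sqnorm /= in h1 h2 *; field; rewrite ?andbT; try (apply/andP; split); apply/eqP; nra.
Qed.

End Shapes.

Arguments T3_shape {R} z.
Arguments T3inv_shape {R} z.

(** * Expanding quantities *)

Section Dynamics.
Variable R : realType.

(** As long as the orbit stays in [D], the size of [u] grows at least like the
    affine function n |-> 1 + n (k - 1), by Bernoulli's inequality. *)
Lemma expanding_never_leaves (T : Type) (D : pred T) (f : T -> T) (u : T -> R) (k B : R) :
  1 < k -> (forall z, D z -> `|u z| <= B) ->
  (forall z, D z -> D (f z) -> k * `|u z| <= `|u (f z)|) ->
  (forall z, D z -> u z = 0 -> D (f z) /\ u (f z) = 0) ->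
  forall z, D z -> (forall n, D (iter n f z)) <-> u z = 0.
Proof.
move=> k1 uB uk u0 z Dz; split=> [Df | uz n]; last first.
  suff [] : D (iter n f z) /\ u (iter n f z) = 0 by [].
  by elim: n => // n [Dn un]; apply: u0.
have grow n : `|u z| * (1 + n%:R * (k - 1)) <= `|u (iter n f z)|.
  elim: n => [|n IH]; first by rewrite mul0r addr0 mulr1.
  apply: le_trans (uk _ (Df n) (Df n.+1)).
  apply: le_trans (ler_wpM2l (ltW (lt_trans ltr01 k1)) IH).
  rewrite mulrCA ler_wpM2l // mulrSr.
  have : 0 <= n%:R * (k - 1) ^+ 2 by rewrite mulr_ge0 ?sqr_ge0.
  by lra.
apply/eqP; rewrite -normr_eq0; apply/negPn/negP => uz0.
have uz : 0 < `|u z| by rewrite lt_def uz0 /=.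
pose n := Num.bound (B / (`|u z| * (k - 1))).
have d0 : 0 < `|u z| * (k - 1) by rewrite mulr_gt0 // subr_gt0.
have B0 : 0 <= B := le_trans (normr_ge0 _) (uB _ Dz).
have : B / (`|u z| * (k - 1)) < n%:R by apply: archi_boundP; rewrite divr_ge0 // ltW.
rewrite ltr_pdivrMr // => Bn.
have := le_trans (grow n) (uB _ (Df n)).
by nra.
Qed.

Implicit Types z : plane R.

Definition diag_defect z : R := z.1 - z.2.

Definition circle_defect z : R := 1 - sqnorm z.

(** This is |z^2 + s|^2 with s = [diag_defect z]. *)
Definition T3_modulus z : R :=
  let s := diag_defect z in
  s ^+ 2 * (1 + z.1 + z.2) ^+ 2 + (2 * z.1 * z.2) ^+ 2.

Lemma T3_modulus_gt0 z : half_disc z -> 0 < T3_modulus z.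
Proof.
move=> /half_disc_pos[x0 y0]; rewrite /T3_modulus ltr_wpDl //.
  by rewrite mulr_ge0 ?sqr_ge0.
by rewrite exprn_gt0 // !mulr_gt0.
Qed.

(** Only the signs of the coordinates of the image are used, hence the unspecified
    positive factor. *)
Lemma T3_shapeE z : half_disc z -> let s := diag_defect z in
  exists2 k, 0 < k & T3_shape z =
  (k * (z.1 * (2 * z.2 ^+ 2 * (1 - s) - (1 + s) * s * (1 + z.1 + z.2))),
   k * (z.2 * (2 * z.1 ^+ 2 * (1 + s) + (1 - s) * s * (1 + z.1 + z.2)))).
Proof.
move=> hz s; have [x0 y0] := half_disc_pos hz; have H := T3_modulus_gt0 hz.
exists ((z.1 + z.2 + sqnorm z) / (T3_modulus z * (1 + z.1 + z.2))).
  have q0 : 0 <= sqnorm z by rewrite addr_ge0 ?sqr_ge0.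
  by rewrite divr_gt0 ?mulr_gt0 //; lra.
move: H; rewrite /s {s} /T3_shape /T3_modulus /diag_defect.
case: z hz x0 y0 => x y /= hz x0 y0 n0.
rewrite /cdiv /T3_vertex0 /T3_vertex1 /= /sqnorm /=.
congr (_, _); field; repeat (apply/andP; split); nra.
Qed.

Lemma T3_diag_defect z : half_disc z -> diag_defect (T3_shape z) =
  - diag_defect z * ((z.1 + z.2 + sqnorm z) ^+ 2 / T3_modulus z).
Proof.
move=> hz; have [x0 y0] := half_disc_pos hz; have := T3_modulus_gt0 hz.
rewrite /T3_shape /cdiv /T3_vertex0 /T3_vertex1 /T3_modulus /diag_defect /sqnorm.
case: z {hz} x0 y0 => x y /= x0 y0 n0.
by field; repeat (apply/andP; split); nra.
Qed.

(** By [T3_shapeE] this excludes x - y >= 1/2: the first coordinate of the image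
    would not be positive. Exchanging x and y excludes x - y <= - 1/2. *)
Lemma off_diagonal_ineq (x y : R) : 1 < x + y -> x ^+ 2 + y ^+ 2 < x + y -> 0 < y ->
  1 / 2 <= x - y -> 2 * y ^+ 2 * (1 - (x - y)) <= (1 + (x - y)) * (x - y) * (1 + x + y).
Proof.
move=> h1 h2 y0 s; have y1 : y < 1 by nra.
have x1 : x - y < 1 by nra.
(* The left side is at most y^2, as 1 - (x - y) <= 1/2. *)
have : y ^+ 2 < 1 by nra.
have : 3 / 2 <= (1 + (x - y)) * (x - y) * (1 + x + y) by nra.
by nra.
Qed.

Lemma T3_diag_defect_small z : half_disc z -> half_disc (T3_shape z) ->
  `|diag_defect z| < 1 / 2.
Proof.
move=> hz hfz; have [x0 y0] := half_disc_pos hz.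
have [fx0 fy0] := half_disc_pos hfz; move: fx0 fy0.
have [k k0 ->] /= := T3_shapeE hz; rewrite !pmulr_rgt0 //.
rewrite /diag_defect; case: z hz x0 y0 {hfz k0} => x y /andP[/= h1 h2] x0 y0 fx fy.
rewrite /sqnorm /= in h2.
rewrite ltr_norml; apply/andP; split; rewrite ltNge; apply/negP => s.
- by have := @off_diagonal_ineq y x; nra.
- by have := @off_diagonal_ineq x y; nra.
Qed.

(** With s = x - y, the bound |z^2 + s| <= |z|^2 + |s| reduces the claim to
    x + y + |z|^2 >= 6/5 (|z|^2 + |s|). This holds since |z|^2 < 2, x + y > 1
    and |s| < 1/2. Near the corners 1 and i of the half disc the factor tends to
    1, but there |s| is close to 1 and the image is outside the half disc. *)
Lemma T3_expands z : half_disc z -> half_disc (T3_shape z) ->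
  36 / 25 * `|diag_defect z| <= `|diag_defect (T3_shape z)|.
Proof.
move=> hz hfz; have small := T3_diag_defect_small hz hfz.
have [x0 y0] := half_disc_pos hz; have n0 := T3_modulus_gt0 hz.
rewrite T3_diag_defect // normrM normrN mulrC ler_wpM2l // ger0_norm; last first.
  by rewrite divr_ge0 ?sqr_ge0 // ltW.
rewrite ler_pdivlMr //; move: n0; rewrite /T3_modulus.
case: z hz small x0 y0 {hfz} => x y /andP[/= h1 h2]; rewrite /sqnorm /diag_defect /= in h2 *.
set t := `|x - y| => small x0 y0 n0.
have t0 : 0 <= t by exact: normr_ge0.
have t2 : (x - y) ^+ 2 = t ^+ 2 by rewrite real_normK // num_real.
set q := x ^+ 2 + y ^+ 2 in h2 *.
(* |x^2 - y^2| <= |z|^2; this gives |z^2 + s| <= |z|^2 + |s| below. *)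
have tq : t * (x + y) <= q.
  have : t * (x + y) = `|x ^+ 2 - y ^+ 2|.
    by rewrite subr_sqr normrM (ger0_norm (_ : 0 <= x + y)) //; lra.
  move=> ->; rewrite ler_norml /q; apply/andP; split; nra.
have bound : (x - y) ^+ 2 * (1 + x + y) ^+ 2 + (2 * x * y) ^+ 2 <= (q + t) ^+ 2.
  have -> : (2 * x * y) ^+ 2 = q ^+ 2 - t ^+ 2 * (x + y) ^+ 2.
    by rewrite -t2 /q; ring.
  by rewrite t2; nra.
have lin : 6 / 5 * (q + t) <= x + y + q by lra.
have q0 : 0 <= q by rewrite /q addr_ge0 ?sqr_ge0.
apply: le_trans (ler_wpM2l _ bound) _; first by lra.
have -> : 36 / 25 * (q + t) ^+ 2 = (6 / 5 * (q + t)) ^+ 2 by field.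
by rewrite ler_sqr // nnegrE; lra.
Qed.

(** On the axis the map is x |-> (1 + x) / (1 + 2x), which sends the interval
    from 1/2 to 1 into itself. *)
Lemma T3_diagonal z : half_disc z -> diag_defect z = 0 ->
  half_disc (T3_shape z) /\ diag_defect (T3_shape z) = 0.
Proof.
move=> hz s0; split; last by rewrite T3_diag_defect // s0 oppr0 mul0r.
have [x0 y0] := half_disc_pos hz; have := T3_modulus_gt0 hz.
rewrite /T3_modulus; move: s0 => /eqP; rewrite subr_eq0 => /eqP.
case: z hz x0 y0 => x y /andP[/= h1 h2] x0 y0 exy; subst y.
rewrite /diag_defect /= => n0.
have -> : T3_shape (x, x) = ((1 + x) / (1 + 2 * x), (1 + x) / (1 + 2 * x)).
  rewrite /T3_shape /cdiv /T3_vertex0 /T3_vertex1 /sqnorm /=.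
  by congr (_, _); field; repeat (apply/andP; split); nra.
rewrite /sqnorm /= in h2; rewrite /half_disc /sqnorm /=.
set d := (1 + x) / (1 + 2 * x).
have : d * (1 + 2 * x) = 1 + x by rewrite /d; field; lra.
by move=> dE; apply/andP; split; nra.
Qed.

Theorem T3_shape_stays z : half_disc z ->
  (forall n, half_disc (iter n T3_shape z)) <-> diag_defect z = 0.
Proof.
apply: (@expanding_never_leaves _ _ _ _ (36 / 25) 1); first by lra.
- by move=> {}z /half_disc_diff h; rewrite ler_norml; apply/andP; split; rewrite /diag_defect; lra.
- exact: T3_expands.
- exact: T3_diagonal.
Qed.

(** This is |2xy + i s (x + y - 1)|^2 with s = [diag_defect z]. *)
Definition T3inv_modulus z : R :=
  (2 * z.1 * z.2) ^+ 2 + diag_defect z ^+ 2 * (z.1 + z.2 - 1) ^+ 2.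

Lemma T3inv_modulus_gt0 z : half_disc z -> 0 < T3inv_modulus z.
Proof.
move=> /half_disc_pos[x0 y0]; rewrite /T3inv_modulus ltr_wpDr //.
  by rewrite mulr_ge0 ?sqr_ge0.
by rewrite exprn_gt0 // !mulr_gt0.
Qed.

Lemma T3inv_circle_defect z : half_disc z ->
  let m := z.1 + z.2 - 1 in let e := z.1 + z.2 - sqnorm z in
  circle_defect (T3inv_shape z) =
  - circle_defect z *
    ((m + e) / m ^+ 2
     + 2 * z.1 * z.2 * e ^+ 2 / (m ^+ 2 * T3inv_modulus z)).
Proof.
move=> hz m e; have n0 := T3inv_modulus_gt0 hz; rewrite {}/m {}/e.
have [x0 y0] := half_disc_pos hz; move: n0.
rewrite /T3inv_modulus /circle_defect /T3inv_shape /cdiv /diag_defect.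
case: z hz x0 y0 => x y /andP[/= h1 h2] x0 y0 n0.
rewrite /sqnorm /= in h2 *.
by field; repeat (apply/andP; split); nra.
Qed.

Lemma sum_sqr_le z : (z.1 + z.2) ^+ 2 <= 2 * sqnorm z.
Proof.
have := sqr_ge0 (z.1 - z.2); rewrite /sqnorm; lra.
Qed.

Lemma half_disc_sum z : half_disc z -> z.1 + z.2 < 2.
Proof. by case/andP=> h1 h2; have := sum_sqr_le z; nra. Qed.

Lemma half_disc_sqnorm z : half_disc z -> 1 / 2 < sqnorm z < 2.
Proof.
move=> hz; have xy2 := half_disc_sum hz; case/andP: hz => h1 h2.
by have := sum_sqr_le z => sq; apply/andP; split; nra.
Qed.

(** With m = x + y - 1, the factor of [T3inv_circle_defect] is at least 1 / m and
    m < 1, so the defect grows and changes sign. As |z|^2 > 1/2 on the half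
    disc, the positive one of the two defects is less than 1/2; in either
    case |z|^2 < 3/2, which improves the bound to m < 3/4. *)
Lemma T3inv_expands z : half_disc z -> half_disc (T3inv_shape z) ->
  4 / 3 * `|circle_defect z| <= `|circle_defect (T3inv_shape z)|.
Proof.
move=> hz hfz; have [x0 y0] := half_disc_pos hz.
have n0 := T3inv_modulus_gt0 hz; have /= fE := T3inv_circle_defect hz.
have /andP[f1 _] := half_disc_sqnorm hfz.
have /andP[h1 h2] := hz.
set m := z.1 + z.2 - 1 in fE; set e := z.1 + z.2 - sqnorm z in fE.
set k := (_ + _) in fE.
have m0 : 0 < m by rewrite subr_gt0.
have e0 : 0 < e by rewrite subr_gt0.
have km : 1 / m <= k.
  have r0 : 0 <= 2 * z.1 * z.2 * e ^+ 2 / (m ^+ 2 * T3inv_modulus z).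
    by rewrite divr_ge0 ?mulr_ge0 ?exprn_ge0 // ltW.
  apply: le_trans (_ : (m + e) / m ^+ 2 <= _); last by rewrite lerDl.
  by rewrite ler_pdivlMr ?exprn_gt0 // expr2 mulrA mulfVK ?gt_eqF // mul1r lerDl ltW.
have m1 : m < 1.
  by rewrite ltrBlDr; have := half_disc_sum hz; lra.
have k1 : 1 <= k by apply: le_trans km; rewrite ler_pdivlMr // mul1r ltW.
have small : sqnorm z < 3 / 2.
  rewrite ltNge; apply/negP => big.
  by move: fE; rewrite /circle_defect; nra.
have m34 : m < 3 / 4.
  rewrite ltrBlDr; have := sum_sqr_le z; nra.
rewrite fE normrM normrN mulrC ler_wpM2l // ger0_norm; last by lra.
by apply: le_trans km; rewrite ler_pdivlMr //; lra.
Qed.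

Lemma T3inv_shapeE z : half_disc z -> let s := diag_defect z in
  let m := z.1 + z.2 - 1 in
  exists2 k, 0 < k & T3inv_shape z =
  (k * (z.1 * (2 * z.2 ^+ 2 * (1 + s) - (1 - s) * s * m)),
   k * (z.2 * (2 * z.1 ^+ 2 * (1 - s) + (1 + s) * s * m))).
Proof.
move=> hz s m; have [x0 y0] := half_disc_pos hz; have n0 := T3inv_modulus_gt0 hz.
exists ((z.1 + z.2 - sqnorm z) / (m * T3inv_modulus z)).
  by case/andP: hz => h1 h2; rewrite divr_gt0 ?mulr_gt0 // /m; lra.
move: n0; rewrite /m /s {s m} /T3inv_shape /T3inv_modulus /diag_defect.
case: z hz x0 y0 => x y /andP[/= h1 h2] x0 y0 n0.
rewrite /cdiv /T3inv_vertex0 /T3inv_vertex1 /sqnorm /= in h2 *.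
by congr (_, _); field; repeat (apply/andP; split); nra.
Qed.

(** On the unit circle (1 - (x - y)) (1 + (x - y)) = 2 x y, so 1 + (x - y) times
    this quantity is 2 y (y (1 + (x - y))^2 - x (x - y) (x + y - 1)). *)
Lemma circle_ineq (x y : R) : 0 < x -> 0 < y -> 1 < x + y ->
  x ^+ 2 + y ^+ 2 = 1 ->
  0 < 2 * y ^+ 2 * (1 + (x - y)) - (1 - (x - y)) * (x - y) * (x + y - 1).
Proof.
move=> x0 y0 h c; have x1 : x < 1 by nra.
have y1 : y < 1 by nra.
have s1 : 0 < 1 + (x - y) by lra.
rewrite -(pmulr_rgt0 _ s1).
have -> : (1 + (x - y)) *
    (2 * y ^+ 2 * (1 + (x - y)) - (1 - (x - y)) * (x - y) * (x + y - 1)) =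
  2 * y * (y * (1 + (x - y)) ^+ 2 - x * (x - y) * (x + y - 1))
  + (x ^+ 2 + y ^+ 2 - 1) * (x - y) * (x + y - 1) by ring.
rewrite c subrr !mul0r addr0 pmulr_rgt0 ?mulr_gt0 // subr_gt0.
case: (lerP (x - y) 0) => s.
  apply: le_lt_trans (_ : 0 < _); last by rewrite mulr_gt0 ?exprn_gt0.
  by rewrite -mulrA mulr_ge0_le0 ?mulr_le0_ge0 //; nra.
have m0 : 0 < x + y - 1 by lra.
have t1 : x * (x - y) < 1 by nra.
have : x * (x - y) * (x + y - 1) < y by nra.
by nra.
Qed.

(** The image is again on the unit circle, and the points of the unit circle in
    the half disc are those of the open first quadrant. *)
Lemma T3inv_circle z : half_disc z -> circle_defect z = 0 ->
  half_disc (T3inv_shape z) /\ circle_defect (T3inv_shape z) = 0.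
Proof.
move=> hz c0.
have fc : circle_defect (T3inv_shape z) = 0.
  by rewrite T3inv_circle_defect // c0 oppr0 mul0r.
split=> //; have fn : sqnorm (T3inv_shape z) = 1.
  by apply/esym/eqP; rewrite -subr_eq0 -/(circle_defect _) fc.
have [fx fy] : 0 < (T3inv_shape z).1 /\ 0 < (T3inv_shape z).2.
  have [x0 y0] := half_disc_pos hz; have /andP[h1 _] := hz.
  have n1 : z.1 ^+ 2 + z.2 ^+ 2 = 1.
    by apply/esym/eqP; rewrite -subr_eq0; apply/eqP.
  have n1' : z.2 ^+ 2 + z.1 ^+ 2 = 1 by rewrite addrC.
  have [k k0 ->] := T3inv_shapeE hz; rewrite /= !pmulr_rgt0 //.
  split; first exact: circle_ineq.
  have := circle_ineq y0 x0 _ n1'; rewrite (addrC z.2) => /(_ h1).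
  by rewrite /diag_defect; lra.
move: fn; rewrite /half_disc; case: (T3inv_shape z) fx fy => x y /=.
by rewrite /sqnorm /= => x0 y0 n1; apply/andP; split; nra.
Qed.

Theorem T3inv_shape_stays z : half_disc z ->
  (forall n, half_disc (iter n T3inv_shape z)) <-> circle_defect z = 0.
Proof.
apply: (@expanding_never_leaves _ _ _ _ (4 / 3) 1); first by lra.
- by move=> {}z /half_disc_sqnorm h; rewrite ler_norml; apply/andP; split; rewrite /circle_defect; lra.
- exact: T3inv_expands.
- exact: T3inv_circle.
Qed.

End Dynamics.

(** * Convex orbits and orbits of shapes *)

Section Orbits.
Variable R : realType.
Implicit Types (c a z : plane R) (s : bool) (P Q : octagon R).

(** An orbit of octagons is followed by the orbit of shapes for as long as it is
    convex, which is all that is needed: the step [T3_oct] or [T3inv_oct] holds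
    for convex shapes only. *)
Lemma convex_orbit_shapes (T : octagon R -> option (octagon R))
    (f : plane R -> plane R) :
  (forall c a s z, a != 0 -> half_disc z -> exists2 a', a' != 0 &
     T (affine_octagon (oct c a s z)) =
       Some (affine_octagon (oct c a' s (f z)))) ->
  forall c a s z, a != 0 ->
  (forall n, exists2 Q,
     iter n (obind T) (Some (affine_octagon (oct c a s z))) = Some Q & convex Q)
  <-> (forall n, half_disc (iter n f z)).
Proof.
move=> Tf c a s z a0; pose x n := iter n (obind T) (Some (affine_octagon (oct c a s z))).
have next n : half_disc (iter n f z) ->
    (exists2 a', a' != 0 & x n = Some (affine_octagon (oct c a' s (iter n f z)))) ->
    exists2 a', a' != 0 & x n.+1 = Some (affine_octagon (oct c a' s (iter n.+1 f z))).
  by move=> hn [a' a'0 xn]; rewrite /x iterS -/(x n) xn /=; apply: Tf.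
split=> [cvx n | hz n].
  have shape m : exists2 a', a' != 0 & x m = Some (affine_octagon (oct c a' s (iter m f z))).
    elim: m => [|m IH]; first by exists a.
    apply: next (IH); have [a' _ xm] := IH; have [Q] := cvx m.
    by rewrite -/(x m) xm => -[<-] /convex_half_disc.
  have [a' _ xn] := shape n; have [Q] := cvx n.
  by rewrite -/(x n) xn => -[<-] /convex_half_disc.
have [a' a'0 xn] : exists2 a', a' != 0 & x n = Some (affine_octagon (oct c a' s (iter n f z))).
  by elim: n => [|n IH]; [exists a | apply: next IH].
exists (affine_octagon (oct c a' s (iter n f z))) => //.
by apply/strictly_convex_convex/oct_convex.
Qed.

Lemma convex_forward c a s z : a != 0 -> half_disc z ->
  (forall j : int, 0 <= j -> orbit_convex_at (affine_octagon (oct c a s z)) j)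
  <-> diag_defect z = 0.
Proof.
move=> a0 hz; rewrite -(T3_shape_stays hz) -(convex_orbit_shapes (@T3_oct R) c s z a0).
by split=> [cvx n | cvx [n|//] _]; [exact: (cvx n) | exact: cvx].
Qed.

Lemma convex_backward c a s z : a != 0 -> half_disc z ->
  (forall j : int, j <= 0 -> orbit_convex_at (affine_octagon (oct c a s z)) j)
  <-> circle_defect z = 0.
Proof.
move=> a0 hz; rewrite -(T3inv_shape_stays hz) -(convex_orbit_shapes (@T3inv_oct R) c s z a0).
split=> [cvx [|n] | cvx [[|n]|n] // _].
- exact: (cvx 0).
- exact: (cvx (Negz n)).
- exact: (cvx 0%N).
- exact: (cvx n.+1).
Qed.

End Orbits.

(** * Rotations and reflections *)

Section Symmetry.
Variable R : realType.
Implicit Types (c a b u v w x z : plane R) (s : bool) (t : R) (p : plane_octagon R).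

Lemma rotation_half c x : rotation c (pi / 2) x = c + quarter (x - c).
Proof. by rewrite /rotation cos_pihalf sin_pihalf !mul0r !mul1r add0r addr0. Qed.

Lemma rotationD c t t' x :
  rotation c (t + t') x = rotation c t (rotation c t' x).
Proof. by rewrite /rotation cosD sinD /=; congr (_, _); ring. Qed.

Lemma rotation0 c x : rotation c 0 x = x.
Proof.
case: x => x y; rewrite /rotation cos0 sin0 !mul0r !mul1r subr0 add0r /=.
by rewrite !(addrC c.1) !(addrC c.2) !subrK.
Qed.

Lemma reflectionD c t t' x :
  reflection c (t + t') x = rotation c (2 * t') (reflection c t x).
Proof.
by rewrite /rotation /reflection (mulrDr 2) cosD sinD /=; congr (_, _); ring.
Qed.

Lemma cos_double t : cos (2 * t) = cos t ^+ 2 - sin t ^+ 2.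
Proof. by rewrite mulr_natl mulr2n cosD -!expr2. Qed.

Lemma sin_double t : sin (2 * t) = 2 * sin t * cos t.
Proof. by rewrite mulr_natl mulr2n sinD; ring. Qed.

Lemma reflection_fix_on_line c t x : reflection c t x = x -> on_line c t x.
Proof.
case: x => x y [] /=; rewrite cos_double sin_double /on_line /=.
have := cos2Dsin2 t; move: (cos t) (sin t) => C S CS1.
move=> h1 h2; apply/eqP; rewrite -subr_eq0; set D := (_ - _).
have CS1X := congr1 ( *%R (x - c.1)) CS1.
have CS1Y := congr1 ( *%R (y - c.2)) CS1.
(* In coordinates the hypothesis says that - 2 S D = 0 and 2 C D = 0. *)
have SD : S * D = 0 by rewrite /D; lra.
have CD : C * D = 0 by rewrite /D; lra.
have -> : D = C * (C * D) + S * (S * D).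
  by rewrite -[LHS]mul1r -CS1; ring.
by rewrite SD CD !mulr0 addr0.
Qed.

(** The angle is an arc cosine up to sign, the sign being that of the second
    coordinate. *)
Lemma polar w : w != 0 -> exists r t, 0 < r /\ w = (r * cos t, r * sin t).
Proof.
move=> w0; pose r := Num.sqrt (sqnorm w).
have n0 : 0 < sqnorm w by rewrite lt_def sqnorm_eq0 w0 addr_ge0 ?sqr_ge0.
have r0 : 0 < r by rewrite sqrtr_gt0.
have r2 : r ^+ 2 = sqnorm w by rewrite sqr_sqrtr // ltW.
have bound : -1 <= w.1 / r <= 1.
  rewrite ler_pdivlMr // ler_pdivrMr // mulN1r mul1r -ler_norml.
  rewrite -ler_sqr ?nnegrE ?(ltW r0) // real_normK ?num_real // r2.
  by rewrite lerDl sqr_ge0.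
have sin2 : r * Num.sqrt (1 - (w.1 / r) ^+ 2) = `|w.2|.
  rewrite -sqrtr_sqr -{1}(ger0_norm (ltW r0)) -sqrtr_sqr -sqrtrM ?sqr_ge0 //.
  congr Num.sqrt; rewrite mulrBr mulr1 exprMn exprVn mulrCA mulfV;
    last by rewrite expf_neq0 // gt_eqF.
  by rewrite mulr1 r2 /sqnorm addrC addKr.
have cosE : r * (w.1 / r) = w.1 by rewrite mulrC mulfVK // gt_eqF.
case: (lerP 0 w.2) => y0.
- exists r, (acos (w.1 / r)); split=> //; rewrite sin_acos // acosK // ?in_itv //.
  by rewrite cosE sin2 ger0_norm //; case: (w).
- exists r, (- acos (w.1 / r)); split=> //; rewrite sinN cosN sin_acos // acosK // ?in_itv //.
  by rewrite cosE mulrN sin2 ltr0_norm // opprK; case: (w).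
Qed.

Lemma cos_sin_pi4 : cos (pi / 4 : R) = sin (pi / 4) /\ 0 < cos (pi / 4 : R) .
Proof.
have c0 : 0 < cos (pi / 4 : R).
  by apply: cos_gt0_pihalf; have := pi_gt0 R; move=> ?; apply/andP; split; lra.
by split=> //; have := tan_piquarter R; rewrite /tan => /(congr1 ( *%R^~ (cos (pi / 4))));
  rewrite mulfVK ?mul1r // gt_eqF.
Qed.

End Symmetry.

(** * Symmetric octagons *)

Section SymmetricOctagons.
Variable R : realType.
Implicit Types (c a b u v w x z : plane R) (s : bool) (t r : R) (p : plane_octagon R).

(** The effect on labels of the counterclockwise quarter turn: it depends on
    whether the octagon is labeled counterclockwise or clockwise. *)
Definition quarter_shift s : 'Z_8 := if s then - 2%:R else 2%:R.

(** The mirrors of a dihedral octagon act on labels by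
    i |-> k0 - i + quarter_shift s *+ k. The next two lemmas solve
    quarter_shift s *+ k = i + i for i and for k; they match the mirrors with
    the vertices (k0 = 0) or the edges (k0 = 1). *)
Lemma quarter_shift_double s (k : nat) : exists i, i + i = quarter_shift s *+ k.
Proof.
by exists ((if s then -1 else 1) *+ k); rewrite -mulrnDl; congr (_ *+ _);
  case: s; apply: val_inj.
Qed.

Lemma double_quarter_shift s i : exists k : 'I_4, quarter_shift s *+ k = i + i.
Proof.
by case: s; case: i => [[|[|[|[|[|[|[|[|]]]]]]]]] // ?;
  first [ by exists (@Ordinal 4 0 isT); apply: val_inj
        | by exists (@Ordinal 4 1 isT); apply: val_inj
        | by exists (@Ordinal 4 2 isT); apply: val_inj
        | by exists (@Ordinal 4 3 isT); apply: val_inj ].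
Qed.

Lemma rotation_simil_quarter c a s u :
  rotation c (pi / 2) (simil c a s (if s then quarter u else u)) =
  simil c a s (if s then u else quarter u).
Proof.
by rewrite rotation_half !similE; case: s; congr (_, _) => /=; ring.
Qed.

Lemma rotation_oct c a s z i :
  rotation c (pi / 2) (oct c a s z i) = oct c a s z (i + quarter_shift s).
Proof.
have := rotation_simil_quarter c a s; rewrite /oct /quarter_shift; case: s => H.
  by rewrite -{1}(subrK 2%:R i) /model turns_add2 H.
by rewrite /model turns_add2 H.
Qed.

Lemma rotation_oct_iter c a s z i n :
  rotation c (n%:R * (pi / 2)) (oct c a s z i) = oct c a s z (i + quarter_shift s *+ n).
Proof.
elim: n => [|n IH]; first by rewrite mul0r rotation0 addr0.
by rewrite mulrS mulrDl mul1r rotationD IH rotation_oct -addrA -mulrSr.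
Qed.

(** The center [c] and the vertex [a] fix the similarity, which reverses the
    orientation ([s] is true) if the rotation shifts labels by -2. Convexity
    excludes that [a] is 0: the vertices with even labels would coincide. *)
Lemma symmetric_octagon p : rotation_symmetric4 p -> convex (affine_octagon p) ->
  exists c a s z, [/\ a != 0, half_disc z & p = oct c a s z].
Proof.
move=> [c sym] cvx.
have rot_inj : injective (rotation c (pi / 2)).
  move=> x y; rewrite !rotation_half => /addrI [/oppr_inj/addIr e2 /addIr e1].
  by case: (x) (y) e1 e2 => ? ? [? ?] /= -> ->.
have [s rot_p] : exists s, forall i,
    if s then rotation c (pi / 2) (p (i + 2%:R)) = p i
    else rotation c (pi / 2) (p i) = p (i + 2%:R).
  by case: sym => sym; [exists false | exists true] => i //; rewrite sym addrK.
set a := p 0 - c.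
have a0 : a != 0.
  apply/negP; rewrite subr_eq0 => /eqP p0.
  have rot_c : rotation c (pi / 2) c = c.
    by rewrite rotation_half subrr /quarter oppr0 addr0.
  have p2 : p 2%:R = c.
    have := rot_p 0; rewrite add0r p0; case: (s) => [e|<-//].
    by apply: rot_inj; rewrite e rot_c.
  have [l /(_ 0 2%:R isT isT)] := convex_signs cvx.
  by rewrite p2 p0 (_ : orient _ _ _ = 0) ?mulr0 ?ltxx // /orient; ring.
have conj_ifK u : conj_if s (conj_if s u) = u.
  by case: u => x y; rewrite /conj_if /= signrMK.
pose z := conj_if s (cdiv (p 1 - c) a).
have pE : p = oct c a s z.
  apply/funext; elim/Z8_ind2 => [||i IH].
  - rewrite /oct /model turns0 similE /= !mulr0 !mulr1 subr0 add0r.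
    by rewrite !(addrC c.1) !(addrC c.2) /a !subrK; case: (p 0).
  - by rewrite /oct /model turns1 /simil conj_ifK cmulK // addrC subrK.
  - rewrite /oct /model turns_add2; have := rot_p i.
    have := rotation_simil_quarter c a s (turns (1, 0) z i).
    rewrite IH /oct /model; case: (s) => [<- /rot_inj | ->] //.
exists c, a, s, z; split=> //.
by apply: (@convex_half_disc _ c a s); rewrite -pE.
Qed.

Lemma half_turnE c x : rotation c (2%:R * (pi / 2)) x = (2 * c.1 - x.1, 2 * c.2 - x.2).
Proof.
rewrite mulrC mulfVK ?pnatr_eq0 // /rotation cospi sinpi.
by congr (_, _); ring.
Qed.

(** The sum of the vertices is preserved by every symmetry of the octagon, so the
    center of a half turn can only be their mean. *)
Lemma half_turn_center c p : preserves (rotation c (2%:R * (pi / 2))) p ->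
  (8 * c.1, 8 * c.2) = (\sum_i (p i).1, \sum_i (p i).2).
Proof.
move=> pres.
have sums (f : plane R -> R) :
    \sum_i f (rotation c (2%:R * (pi / 2)) (p i)) = \sum_i f (p i).
  case: pres => -[k pE]; under eq_bigr do rewrite pE.
    by rewrite [RHS](reindex_inj (addIr k)).
  by rewrite [RHS](reindex_inj (subrI k)).
have half (d : R) (g : 'Z_8 -> R) :
    \sum_i (2 * d - g i) = \sum_i g i -> 8 * d = \sum_i g i.
  rewrite sumrB.
  have -> : \sum_(i : 'Z_8) 2 * d = 16 * d.
    by rewrite sumr_const card_ord -mulr_natl -[(Zp_trunc 8).+2]/8%N; ring.
  by lra.
congr (_, _); apply: half.
- by rewrite -(sums fst); under [RHS]eq_bigr do rewrite half_turnE.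
- by rewrite -(sums snd); under [RHS]eq_bigr do rewrite half_turnE.
Qed.

Lemma dihedral8_oct_center c c' t a s z :
  dihedral8_preserves c' t (oct c a s z) -> c' = c.
Proof.
move=> /(_ (@Ordinal 4 2 isT)) [/half_turn_center e' _].
have pres : preserves (rotation c (2%:R * (pi / 2))) (oct c a s z).
  by left; exists (quarter_shift s *+ 2) => i; rewrite rotation_oct_iter.
have := half_turn_center pres; rewrite -e' => -[e1 e2].
have n8 : 8 != 0 :> R by rewrite pnatr_eq0.
by case: (c) (c') e1 e2 => ? ? [? ?] /= /(mulfI n8) -> /(mulfI n8) ->.
Qed.

(** One mirror suffices: the quarter turn is already a symmetry, and the other
    mirrors are obtained by composing with its powers. *)
Lemma dihedral8_of_mirror c a s z t (k0 : 'Z_8) :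
  (forall i, reflection c t (oct c a s z i) = oct c a s z (k0 - i)) ->
  dihedral8_preserves c t (oct c a s z) /\
  forall (k : 'I_4) i, reflection c (mirror_angle t k) (oct c a s z i) =
    oct c a s z (k0 - i + quarter_shift s *+ k).
Proof.
move=> mir.
have refl (k : 'I_4) i : reflection c (mirror_angle t k) (oct c a s z i) =
    oct c a s z (k0 - i + quarter_shift s *+ k).
  rewrite /mirror_angle reflectionD mir -rotation_oct_iter; congr rotation.
  by field.
split=> // k; split.
  by left; exists (quarter_shift s *+ k) => i; rewrite rotation_oct_iter.
by right; exists (k0 + quarter_shift s *+ k) => i; rewrite refl addrAC.
Qed.

(** The hypothesis on [v] reads b^2 conj(u) = |b|^2 v: it says that [v] is the
    mirror image of [u] in the line through 0 and [b], and the one on [t] that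
    the similarity maps this line to the line with angle [t]. *)
Lemma reflection_simil c a s b u v r t : r != 0 ->
  cmul a (conj_if s b) = (r * cos t, r * sin t) ->
  cmul (cmul b b) (u.1, - u.2) = (sqnorm b * v.1, sqnorm b * v.2) ->
  reflection c t (simil c a s u) = simil c a s v.
Proof.
move=> r0 [e1 e2] [v1 v2].
have r2 : r ^+ 2 = sqnorm a * sqnorm b.
  rewrite -[LHS]mulr1 -(cos2Dsin2 t) mulrDr -!exprMn -e1 -e2 /sqnorm /conj_if.
  by case: s {e1 e2} => /=; ring.
have r20 : r ^+ 2 != 0 by rewrite expf_neq0.
rewrite !similE /reflection cos_double sin_double.
congr (_, _); congr (_ + _); apply: (mulfI r20).
- transitivity (((r * cos t) ^+ 2 - (r * sin t) ^+ 2) * (a.1 * u.1 - a.2 * ((-1) ^+ s * u.2))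
     + 2 * (r * cos t) * (r * sin t) * (a.1 * ((-1) ^+ s * u.2) + a.2 * u.1)).
    by rewrite /=; ring.
  rewrite -e1 -e2 r2.
  transitivity (sqnorm a * (a.1 * (sqnorm b * v.1) - a.2 * ((-1) ^+ s * (sqnorm b * v.2))));
    last by ring.
  by rewrite -v1 -v2 /sqnorm; case: s {e1 e2} => /=; ring.
- transitivity (2 * (r * cos t) * (r * sin t) * (a.1 * u.1 - a.2 * ((-1) ^+ s * u.2))
     - ((r * cos t) ^+ 2 - (r * sin t) ^+ 2) * (a.1 * ((-1) ^+ s * u.2) + a.2 * u.1)).
    by rewrite /=; ring.
  rewrite -e1 -e2 r2.
  transitivity (sqnorm a * (a.1 * ((-1) ^+ s * (sqnorm b * v.2)) + a.2 * (sqnorm b * v.1)));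
    last by ring.
  by rewrite -v1 -v2 /sqnorm; case: s {e1 e2} => /=; ring.
Qed.

End SymmetricOctagons.

(** * Dihedral symmetry and regularity in terms of the shape *)

Section Characterizations.
Variable R : realType.
Implicit Types (c a b u v w x z : plane R) (s : bool) (t r : R) (p : plane_octagon R).

Lemma sin_natpi n : sin (n%:R * pi : R) = 0.
Proof.
elim: n => [|n IH]; first by rewrite mul0r sin0.
by rewrite mulrSr mulrDl mul1r sinD IH sinpi mul0r mulr0 addr0.
Qed.

(** The imaginary part (divided by 4) and the real part of the fourth power.
    The first one vanishes exactly on the four lines through 0 which meet the
    horizontal axis at a multiple of the angle pi / 4. *)
Definition im4 u : R := u.1 * u.2 * (u.1 ^+ 2 - u.2 ^+ 2).
Definition re4 u : R := (u.1 ^+ 2 - u.2 ^+ 2) ^+ 2 - 4 * (u.1 * u.2) ^+ 2.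

Lemma im4_cmul u v : im4 (cmul u v) = im4 u * re4 v + re4 u * im4 v.
Proof. by rewrite /im4 /re4 /cmul /=; ring. Qed.

Lemma re4_im4 u : re4 u ^+ 2 + 16 * im4 u ^+ 2 = sqnorm u ^+ 4.
Proof. by rewrite /im4 /re4 /sqnorm; ring. Qed.

(** Turning back by the angle [t] moves the four mirrors to the four lines on
    which [im4] vanishes. *)
Lemma mirror_im4 c t (k : 'I_4) x : on_line c (mirror_angle t k) x ->
  im4 (cmul (cos t, - sin t) (x - c)) = 0.
Proof.
rewrite /on_line /mirror_angle; set phi := k%:R * _; set th := t + phi => line.
pose q := (x.1 - c.1) * cos th + (x.2 - c.2) * sin th.
have x1 : x.1 - c.1 = q * cos th.
  have := congr1 ( *%R (sin th)) line.
  by have := congr1 ( *%R (x.1 - c.1)) (cos2Dsin2 th); rewrite /q; lra.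
have x2 : x.2 - c.2 = q * sin th.
  have := congr1 ( *%R (cos th)) line.
  by have := congr1 ( *%R (x.2 - c.2)) (cos2Dsin2 th); rewrite /q; lra.
have CS := cos2Dsin2 t.
have -> : cmul (cos t, - sin t) (x - c) = (q * cos phi, q * sin phi).
  rewrite /cmul /= x1 x2 /th cosD sinD; congr (_, _).
  - by rewrite -[RHS]mulr1 -CS; ring.
  - by rewrite -[RHS]mulr1 -CS; ring.
have sin4 : sin (2 * (2 * phi)) = 0.
  have -> : 2 * (2 * phi) = k%:R * pi by rewrite /phi; field.
  exact: sin_natpi.
move: sin4; rewrite sin_double sin_double cos_double /im4 /= => sin4.
have -> : q * cos phi * (q * sin phi) * ((q * cos phi) ^+ 2 - (q * sin phi) ^+ 2)
  = q ^+ 4 / 4 * (2 * (2 * sin phi * cos phi) * (cos phi ^+ 2 - sin phi ^+ 2)) by field.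
by rewrite sin4 mulr0.
Qed.

Lemma simil_sub c a s u : simil c a s u - c = cmul a (conj_if s u).
Proof. by rewrite /simil addrC addKr. Qed.

(** The vertices 0 and 1 seen from the center both have the angle [t] up to a
    multiple of pi / 4, so the argument of z is a multiple of pi / 4; as z is in
    the open first quadrant, it is on the diagonal. *)
Lemma through_vertices_diag c a s z : a != 0 -> half_disc z ->
  dihedral8_through_vertices (oct c a s z) -> diag_defect z = 0.
Proof.
move=> a0 hz [c' [t [pres _ on]]]; have ec := dihedral8_oct_center pres; subst c'.
have [k0 /mirror_im4] := on 0; have [k1 /mirror_im4] := on 1.
rewrite /oct !simil_sub /model turns0 turns1.
have -> : conj_if s (1, 0) = (1, 0) :> plane R by rewrite /conj_if /= mulr0.
have -> : cmul a (1, 0) = a by case: (a) => ? ?; rewrite /cmul /=; congr (_, _); ring.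
set e := (cos t, _).
have -> : cmul e (cmul a (conj_if s z)) = cmul (cmul e a) (conj_if s z).
  by rewrite /cmul; congr (_, _) => /=; ring.
rewrite im4_cmul => e1 e0; move: e1; rewrite e0 mul0r add0r => /eqP.
have e_neq0 : e != 0.
  by rewrite -sqnorm_eq0 /sqnorm /e /= sqrrN cos2Dsin2 oner_eq0.
have re_neq0 : re4 (cmul e a) != 0.
  have := re4_im4 (cmul e a); rewrite e0 expr0n mulr0 addr0 => /eqP.
  apply: contraTneq => ->; rewrite expr0n eq_sym expf_neq0 //.
  by rewrite sqnorm_eq0 cmul_neq0.
rewrite mulf_eq0 (negPf re_neq0) /= /im4 /conj_if /= exprMn sqrr_sign mul1r.
have [x0 y0] := half_disc_pos hz.
rewrite subr_sqr !mulf_eq0 signr_eq0 (gt_eqF x0) (gt_eqF y0).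
rewrite (gt_eqF (addr_gt0 x0 y0)) /= orbF.
by move/eqP.
Qed.

(** A reflection in a line through the center exchanges the vertices 0 and 1, so
    they have the same distance to the center. *)
Lemma circle_of_bisecting c a s z : a != 0 ->
  dihedral8_bisecting_edges (oct c a s z) -> circle_defect z = 0.
Proof.
move=> a0 [c' [t [pres _ /(_ 0) [k [_]]]]]; have ec := dihedral8_oct_center pres; subst c'.
have refl_norm th x : sqnorm (reflection c th x - c) = sqnorm (x - c).
  have := cos2Dsin2 (2 * th); rewrite /sqnorm /reflection /=.
  move: (cos _) (sin _) => C S CS.
  transitivity ((C ^+ 2 + S ^+ 2) * ((x.1 - c.1) ^+ 2 + (x.2 - c.2) ^+ 2)); first by ring.
  by rewrite CS mul1r.
move/(congr1 (fun x => sqnorm (x - c))); rewrite refl_norm /oct !simil_sub.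
rewrite add0r /model turns0 turns1 /circle_defect.
have norm_cmul u : sqnorm (cmul a (conj_if s u)) = sqnorm a * sqnorm u.
  by rewrite /sqnorm /conj_if; case: (s) => /=; ring.
have n0 : sqnorm a != 0 by rewrite sqnorm_eq0.
rewrite !norm_cmul => /(mulfI n0) <-.
by rewrite /sqnorm /=; ring.
Qed.

Lemma reflection_swap c t x y : reflection c t x = y -> reflection c t y = x.
Proof.
move=> <-; have CS := cos2Dsin2 (2 * t).
rewrite /reflection; case: x => x1 x2 /=; congr (_, _).
- transitivity (c.1 + (cos (2 * t) ^+ 2 + sin (2 * t) ^+ 2) * (x1 - c.1)); first by ring.
  by rewrite CS; ring.
- transitivity (c.2 + (cos (2 * t) ^+ 2 + sin (2 * t) ^+ 2) * (x2 - c.2)); first by ring.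
  by rewrite CS; ring.
Qed.

Lemma reflection_midpoint c t x y : reflection c t x = y ->
  bisects c t x y.
Proof.
move=> xy; split=> //; apply: reflection_fix_on_line.
have := reflection_swap xy; move: xy; case: x y => [x1 x2] [y1 y2].
rewrite /reflection /midpoint /= => -[h1 h2] [h3 h4].
by congr (_, _) => /=; lra.
Qed.

(** The mirror through the vertex 0 is the real axis of the model, and complex
    conjugation maps z to -iz if x = y. *)
Lemma diag_through_vertices c a s z : a != 0 -> half_disc z ->
  diag_defect z = 0 -> dihedral8_through_vertices (oct c a s z).
Proof.
move=> a0 hz /eqP; rewrite subr_eq0 => /eqP zE.
have [r [t [r0 at_]]] := polar a0.
have mir i : reflection c t (oct c a s z i) = oct c a s z (0 - i).
  apply: (@reflection_simil _ c a s (1, 0) _ _ r); first by rewrite gt_eqF.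
    by rewrite -at_ /cmul /=; case: (a) => a1 a2; congr (_, _) => /=; ring.
  have -> : model z (0 - i) = ((model z i).1, - (model z i).2).
    rewrite sub0r; elim/Z8_ind2: i => [||i IH].
    - by rewrite oppr0 /model turns0 oppr0.
    - by case: z zE {hz} => x y /= ->; rewrite /model /turns /= /quarter /= opprK.
    - have e : - i = - (i + 2%:R) + 2%:R by rewrite opprD subrK.
      move: IH; rewrite {1}e /model !turns_add2 /quarter /= => -[e1 e2].
      by case: (turns _ _ _) e1 e2 => u v /= e1 e2; congr (_, _); lra.
  by rewrite /sqnorm /cmul; congr (_, _) => /=; ring.
have [pres refl] := dihedral8_of_mirror mir.
exists c, t; split=> // [k | i].
  have [i ik] := quarter_shift_double s k; exists i; apply: reflection_fix_on_line.
  by rewrite refl -ik sub0r addKr.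
have [k ik] := double_quarter_shift s i; exists k; apply: reflection_fix_on_line.
by rewrite refl ik sub0r addKr.
Qed.

(** If |z| = 1 then u |-> z conj(u) is the reflection of the model in the line
    through 0 and 1 + z, which exchanges 1 and z. *)
Lemma circle_bisecting c a s z : a != 0 -> half_disc z ->
  circle_defect z = 0 -> dihedral8_bisecting_edges (oct c a s z).
Proof.
move=> a0 hz /eqP; rewrite subr_eq0 eq_sym => /eqP z1.
have [x0 y0] := half_disc_pos hz.
pose b : plane R := (1 + z.1, z.2).
have b0 : b != 0 by apply/eqP => -[_ /eqP]; rewrite gt_eqF.
have [r [t [r0 at_]]] := polar (cmul_neq0 a0 (conj_if_neq0 s b0)).
have mir i : reflection c t (oct c a s z i) = oct c a s z (1 - i).
  apply: (reflection_simil _ _ at_); first by rewrite gt_eqF.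
  have -> : model z (1 - i) = cmul z ((model z i).1, - (model z i).2).
    elim/Z8_ind2: i => [||i IH].
    - by rewrite subr0 /model turns1 turns0; case: (z) => x y; rewrite /cmul /=; congr (_, _); ring.
    - rewrite subrr /model turns1 turns0 /cmul /=; move: z1; rewrite /sqnorm => z1.
      by congr (_, _); lra.
    - have e : 1 - i = 1 - (i + 2%:R) + 2%:R by rewrite opprD -!addrA addNr addr0.
      move: IH; rewrite {1}e /model !turns_add2 /quarter /cmul /= => -[e1 e2].
      by case: (turns _ _ (1 - _)) e1 e2 => u v /= e1 e2; congr (_, _); lra.
  have bb : cmul b b = (sqnorm b * z.1, sqnorm b * z.2).
    have -> : sqnorm b = 2 + 2 * z.1 by move: z1; rewrite /sqnorm /b /=; lra.
    by move: z1; rewrite /sqnorm /cmul /b /= => z1; congr (_, _); lra.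
  by rewrite bb /cmul; congr (_, _) => /=; ring.
have [pres refl] := dihedral8_of_mirror mir.
have swap i (k : 'I_4) : i + i = quarter_shift s *+ k ->
    bisects c (mirror_angle t k) (oct c a s z i) (oct c a s z (i + 1)).
  by move=> ik; apply: reflection_midpoint; rewrite refl -ik addrA subrK addrC.
exists c, t; split=> // [k | i].
  by have [i ik] := quarter_shift_double s k; exists i; apply: swap.
by have [k ik] := double_quarter_shift s i; exists k; apply: swap.
Qed.

Lemma cos_sign s t : cos ((-1) ^+ s * t) = cos t.
Proof. by case: s; rewrite ?expr0 ?expr1 ?mul1r ?mulN1r ?cosN. Qed.

Lemma sin_sign s t : sin ((-1) ^+ s * t) = (-1) ^+ s * sin t.
Proof. by case: s; rewrite ?expr0 ?expr1 ?mul1r ?mulN1r ?sinN. Qed.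

(** The center of the circle is the center of rotation, being the midpoint of two
    opposite vertices; then z is exp (i pi / 4) or its conjugate, and the latter
    is not in the half disc. *)
Lemma regular_defects c a s z : a != 0 -> half_disc z -> regular (oct c a s z) ->
  diag_defect z = 0 /\ circle_defect z = 0.
Proof.
move=> a0 hz [c' [r [t [s' [r0 pE]]]]].
have [x0 y0] := half_disc_pos hz; have [cs h0] := cos_sin_pi4 R.
have at_nat (n : nat) (i : 'Z_8) : nat_of_ord i = n -> oct c a s z i =
    (c'.1 + r * (cos t * cos (n%:R * (pi / 4))
                 - sin t * ((-1) ^+ s' * sin (n%:R * (pi / 4)))),
     c'.2 + r * (sin t * cos (n%:R * (pi / 4))
                 + cos t * ((-1) ^+ s' * sin (n%:R * (pi / 4))))).
  by move=> <-; rewrite pE cosD sinD cos_sign sin_sign.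
have := at_nat 0%N 0 erefl; have := at_nat 4%N 4%:R erefl.
have := at_nat 1%N 1 erefl; rewrite mul1r mul0r -cs.
rewrite (_ : 4%:R * (pi / 4) = pi :> R); last by field.
rewrite cos0 sin0 cospi sinpi /oct !similE /model /turns /quarter /=.
have := cos2Dsin2 (pi / 4 : R); rewrite -cs; move: (cos (pi / 4)) h0 => h h0 hh.
have := cos2Dsin2 t; move: (cos t) (sin t) => C S CS.
move=> [e11 e12] [e41 e42] [e01 e02].
have c1 : c.1 = c'.1 by lra.
have c2 : c.2 = c'.2 by lra.
have a1 : a.1 = r * C by lra.
have a2 : a.2 = r * S by lra.
have rn0 : r != 0 by rewrite gt_eqF.
rewrite c1 a1 a2 in e11; rewrite c2 a1 a2 in e12.
set y1 : R := _ * z.2 in e11 e12; set h1 : R := (-1) ^+ s' * h in e11 e12.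
have f1 : C * z.1 - S * y1 = C * h - S * h1.
  by apply: (mulfI rn0); move: (y1) (h1) e11 => *; lra.
have f2 : C * y1 + S * z.1 = S * h + C * h1.
  by apply: (mulfI rn0); move: (y1) (h1) e12 => *; lra.
have xh : z.1 = h.
  rewrite -[LHS]mul1r -[RHS]mul1r -CS.
  transitivity (C * (C * z.1 - S * y1) + S * (C * y1 + S * z.1)); first by ring.
  by rewrite f1 f2; ring.
have yh : y1 = h1.
  rewrite -[LHS]mul1r -[RHS]mul1r -CS.
  transitivity (C * (C * y1 + S * z.1) - S * (C * z.1 - S * y1)); first by ring.
  by rewrite f1 f2; ring.
have y_h : z.2 = h.
  by move: yh; rewrite /y1 /h1; case: (s) (s') => -[] /=; rewrite ?expr0 ?expr1 => ?; lra.
by rewrite /diag_defect /circle_defect /sqnorm xh y_h; split; lra.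
Qed.

Lemma regular_of_defects c a s z : a != 0 -> half_disc z ->
  diag_defect z = 0 -> circle_defect z = 0 -> regular (oct c a s z).
Proof.
move=> a0 hz /eqP; rewrite subr_eq0 => /eqP zE.
rewrite /circle_defect /sqnorm -zE => /eqP; rewrite subr_eq0 => /eqP n1.
have [x0 _] := half_disc_pos hz; have [cs h0] := cos_sin_pi4 R.
have [r [t [r0 aE]]] := polar a0.
have xh : z.1 = cos (pi / 4).
  have := cos2Dsin2 (pi / 4 : R); rewrite -cs => cc; nra.
have modelE n : model z n%:R = (cos (n%:R * (pi / 4)), sin (n%:R * (pi / 4))).
  suff [] : model z n%:R = (cos (n%:R * (pi / 4)), sin (n%:R * (pi / 4))) /\
    model z n.+1%:R = (cos (n.+1%:R * (pi / 4)), sin (n.+1%:R * (pi / 4))) by [].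
  elim: n => [|n [IH1 IH2]]; split=> //.
  - by rewrite mul0r cos0 sin0.
  - by rewrite mul1r -cs -xh /model turns1 {2}zE; case: (z).
  - have -> : n.+2%:R = n%:R + 2%:R :> 'Z_8 by rewrite -natrD addn2.
    rewrite /model turns_add2 -/(model z _) IH1.
    have -> : n.+2%:R * (pi / 4) = n%:R * (pi / 4) + pi / 2 :> R.
      by rewrite -addn2 natrD; field.
    by rewrite cosDpihalf sinDpihalf.
exists c, r, t, s; split=> // i /=.
rewrite /oct -[i in model z i]natr_Zp modelE similE aE /= cosD sinD.
by case: s; rewrite ?expr0 ?expr1 ?mul1r ?mulN1r ?cosN ?sinN; congr (_, _); ring.
Qed.

End Characterizations.

Theorem theorem1p2 (R : realType) (p : plane_octagon R)
    (p_convex : convex (affine_octagon p))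
    (p_symmetric : rotation_symmetric4 p) :
  [/\ regular p <->
        (forall j : int, orbit_convex_at (affine_octagon p) j),
      dihedral8_through_vertices p <->
        (forall j : int, 0 <= j -> orbit_convex_at (affine_octagon p) j)
    & dihedral8_bisecting_edges p <->
        (forall j : int, j <= 0 -> orbit_convex_at (affine_octagon p) j)].
Proof.
have [c [a [s [z [a0 hz ->]]]]] := symmetric_octagon p_symmetric p_convex.
have forward := convex_forward c s a0 hz.
have backward := convex_backward c s a0 hz.
split.
- split=> [/(regular_defects a0 hz)[/forward fw /backward bw] j | cvx].
    by case: (lerP 0 j) => [/fw | /ltW/bw].
  by apply: regular_of_defects => //; [apply/forward | apply/backward] => j _.
- rewrite forward; split; first exact: through_vertices_diag.
  exact: diag_through_vertices.
- rewrite backward; split; first exact: circle_of_bisecting.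
  exact: circle_bisecting.
Qed.
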